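(* Let $m,n,m',n'\in\mathbb N$, $\delta,\delta'\in\{\pm1\}$, $\lambda,\lambda'\in\mathbb C\setminus\{0\}$, and let $\ell,\ell'$ be integers with $0\le\ell\le m+n$ and $0\le\ell'\le m'+n'$. Then the $\mathcal H_q$-module $(L_m\otimes L_n)^{\delta,\lambda}(\delta q^{m+n-2\ell})$ is isomorphic to $(L_{m'}\otimes L_{n'})^{\delta',\lambda'}(\delta' q^{m'+n'-2\ell'})$ if and only if $\delta=\delta'$ and $(m',n',\ell',\lambda')\in\{(m,n,\ell,\lambda),\ (m+n-\ell,\ell,n,\lambda q^{\ell-n}),\ (\ell,m+n-\ell,m,\lambda q^{\ell-m}),\ (n,m,m+n-\ell,\lambda q^{2\ell-m-n})\}$.
   Context: Throughout, $q$ is a nonzero complex number that is not a root of unity; $[x,y]=xy-yx$, $[x,y]_q=qxy-q^{-1}yx$, $[n]_q=\frac{q^n-q^{-n}}{q-q^{-1}}$. $\mathfrak{W}_q$ is the algebra over $\mathbb C$ generated by $E_1,E_2,F_1,F_2,K_1^{\pm1},K_2^{\pm1},I^{\pm1}$ subject to: $I$ is central; $II^{-1}=I^{-1}I=1$, $K_1K_1^{-1}=K_1^{-1}K_1=1$, $K_2K_2^{-1}=K_2^{-1}K_2=1$; $[K_1,E_2]=[K_1,F_2]=[K_1,K_2]=[K_2,E_1]=[K_2,F_1]=0$; $[E_1,K_1]_q=[K_1,F_1]_q=[E_2,K_2]_q=[K_2,F_2]_q=0$; $[E_1,E_2]=[E_1,F_2]=[F_1,E_2]=[F_1,F_2]=0$;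 $[E_1,F_1]=\frac{K_1-IK_1^{-1}}{q-q^{-1}}$; $[E_2,F_2]=\frac{IK_2-K_2^{-1}}{q-q^{-1}}$. The universal $q$-Hahn algebra $\mathcal H_q$ is the algebra generated by $A,B,C$ subject to the relations that each of $\frac{[B,C]_q}{q^2-q^{-2}}+A$, $[C,A]_q$, $\frac{[A,B]_q}{q^2-q^{-2}}+C$ commutes with $A,B,C$. Every $\mathfrak{W}_q$-module is an $\mathcal H_q$-module via the algebra homomorphism $\widetilde\natural:\mathcal H_q\to\mathfrak{W}_q$ with $A\mapsto K_2^{-1}$, $B\mapsto (q-q^{-1})^2(E_1+K_1^{-1}E_2)(F_1K_2+F_2)+q^{-1}K_1K_2+qK_1^{-1}K_2^{-1}$, $C\mapsto IK_1^{-1}-q(q-q^{-1})^2E_1F_2K_2^{-1}$. $(L_m\otimes L_n)^{\delta,\lambda}$ is the $\mathfrak{W}_q$-module with basis $v_i^{(m)}\otimes v_j^{(n)}$ ($0\le i\le m$, $0\le j\le n$) on which: $E_1v_i^{(m)}\otimes v_j^{(n)}=\lambda[i]_q[m-i+1]_qv_{i-1}^{(m)}\otimes v_j^{(n)}$ (zero if $i=0$); $E_2v_i^{(m)}\otimes v_j^{(n)}=\delta\lambda[j]_q[n-j+1]_qv_i^{(m)}\otimes v_{j-1}^{(n)}$ (zero if $j=0$); $F_1v_i^{(m)}\otimes v_j^{(n)}=v_{i+1}^{(m)}\otimes v_j^{(n)}$ (zero if $i=m$); $F_2v_i^{(m)}\otimes v_j^{(n)}=v_i^{(m)}\otimes v_{j+1}^{(n)}$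 (zero if $j=n$); $K_1$ acts by $\lambda q^{m-2i}$, $K_2$ by $\delta\lambda^{-1}q^{n-2j}$, $I$ by $\lambda^2$. For a $\mathfrak W_q$-module $V$ and $\theta\in\mathbb C$, $V(\theta)$ denotes the $\theta$-eigenspace of $K_1K_2$ on $V$ (an $\mathcal H_q$-submodule). *)

(* Defs.v *)
From mathcomp Require Import all_boot all_order all_algebra.
From mathcomp Require Export complex reals.
Set Implicit Arguments. Unset Strict Implicit. Unset Printing Implicit Defensive.
Import GRing.Theory.
Local Open Scope ring_scope.

Definition qint (F : fieldType) (q : F) (k : nat) : F :=
  (q ^+ k - q ^- k) / (q - q^-1).

(* index set of the basis v_i^{(m)} (x) v_j^{(n)}, 0<=i<=m, 0<=j<=n *)
Notation Idx m n := ('I_m.+1 * 'I_n.+1)%type.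

(* vectors of (L_m (x) L_n)^{delta,lambda}: coordinate functions on the basis *)
Notation Vec F m n := {ffun Idx m n -> F^o}.

Definition bv (F : fieldType) (m n : nat) (k : Idx m n) : Vec F m n :=
  [ffun k' => ((k' == k) : nat)%:R].

Arguments bv {F m n} k.

Definition linext (F : fieldType) (m n : nat) (img : Idx m n -> Vec F m n)
  (v : Vec F m n) : Vec F m n := \sum_k v k *: img k.

Section Ops.
Variables (F : fieldType) (q d l : F) (m n : nat).
Local Notation V := (Vec F m n).

Definition imgE1 (k : Idx m n) : V :=
  let: (i, j) := k in
  if (i : nat) == 0%N then 0
  else (l * qint q i * qint q (m - i + 1)) *: bv (inord i.-1, j).
Definition imgE2 (k : Idx m n) : V :=
  let: (i, j) := k in
  if (j : nat) == 0%N then 0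
  else (d * l * qint q j * qint q (n - j + 1)) *: bv (i, inord j.-1).
Definition imgF1 (k : Idx m n) : V :=
  let: (i, j) := k in
  if (i : nat) == m then 0 else bv (inord i.+1, j).
Definition imgF2 (k : Idx m n) : V :=
  let: (i, j) := k in
  if (j : nat) == n then 0 else bv (i, inord j.+1).
Definition evK1 (k : Idx m n) : F := l * q ^ ((m%:Z) - (2 * k.1)%N%:Z).
Definition evK2 (k : Idx m n) : F := d * l^-1 * q ^ ((n%:Z) - (2 * k.2)%N%:Z).

Definition opE1 : V -> V := linext imgE1.
Definition opE2 : V -> V := linext imgE2.
Definition opF1 : V -> V := linext imgF1.
Definition opF2 : V -> V := linext imgF2.
Definition opK1 : V -> V := linext (fun k => evK1 k *: bv k).
Definition opK2 : V -> V := linext (fun k => evK2 k *: bv k).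
Definition opK1inv : V -> V := linext (fun k => (evK1 k)^-1 *: bv k).
Definition opK2inv : V -> V := linext (fun k => (evK2 k)^-1 *: bv k).
Definition opI : V -> V := linext (fun k => (l ^+ 2) *: bv k).

(* images of the generators A, B, C of H_q under the homomorphism natural~ *)
Definition opA : V -> V := opK2inv.
Definition opB (v : V) : V :=
  let w := opF1 (opK2 v) + opF2 v in
  (q - q^-1) ^+ 2 *: (opE1 w + opK1inv (opE2 w))
  + q^-1 *: opK1 (opK2 v) + q *: opK1inv (opK2inv v).
Definition opC (v : V) : V :=
  opI (opK1inv v) - (q * (q - q^-1) ^+ 2) *: opE1 (opF2 (opK2inv v)).

Definition inEig (theta : F) (v : V) : bool := opK1 (opK2 v) == theta *: v.
End Ops.

(* The H_q-module (L_m (x) L_n)^{d,l}(theta) is isomorphic to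
   (L_m' (x) L_n')^{d',l'}(theta'): there is a linear map which restricts to
   a linear bijection V(theta) -> V'(theta') intertwining the actions of the
   generators A, B, C of H_q. *)
Definition Hq_iso (F : fieldType) (q : F)
  (d l : F) (m n : nat) (theta : F)
  (d' l' : F) (m' n' : nat) (theta' : F) : Prop :=
  exists f : Vec F m n -> Vec F m' n',
    [/\ (forall (a : F) (u v : Vec F m n), f (a *: u + v) = a *: f u + f v),
        (forall v, inEig q d l theta v -> inEig q d' l' theta' (f v)),
        (forall u v, inEig q d l theta u -> inEig q d l theta v ->
                     f u = f v -> u = v),
        (forall w, inEig q d' l' theta' w ->
                   exists2 v, inEig q d l theta v & f v = w)
      & (forall v, inEig q d l theta v ->
           [/\ f (opA q d l v) = opA q d' l' (f v),
               f (opB q d l v) = opB q d' l' (f v)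
             & f (opC q d l v) = opC q d' l' (f v)])].

(* Main.v *)
Require Import Defs.
From mathcomp Require Import all_boot all_order all_algebra.
From mathcomp Require Import complex reals.
From mathcomp Require Import zify ring.
Import GRing.Theory.
Local Open Scope ring_scope.

(** On the weight space spanned by the [v_i (x) v_j] with [i + j = ll], [A] is
    diagonal with distinct eigenvalues, while [B] and [C] are tridiagonal in [j],
    the off-diagonal part of [C] being determined by [A] and [B].  Hence two such
    modules are isomorphic as soon as, after a shift of [j], their diagonals agree
    and their off-diagonals agree up to a diagonal rescaling; ratios of
    q-factorials provide the rescaling for the involutions exchanging [n] with
    [ll], resp. [m] with [ll], and these generate the orbit of four parameters.

    Conversely every orbit meets the region [n <= ll <= m], where [j] runs over
    [0..n].  There the spectrum of [A] yields [n] and [d / l], and the diagonal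
    coefficients of [C] and [B] at [j = 0] yield [l q^(2 ll - m)] and
    [q^(m+1) + q^-(m+1)]: this recovers all the parameters. *)

(** * Powers of [q], q-integers and coordinates with integer indices *)

Section Coordinates.
Variables (F : fieldType) (q : F).
Hypothesis hq0 : q != 0.
Hypothesis hq : forall k : nat, (0 < k)%N -> q ^+ k != 1.

(** Extends [qint] to integer arguments, so that neighbours and shifts of indices involve no
    truncated subtraction. *)
Definition qz (z : int) : F := (q ^ z - q ^ (- z)) / (q - q^-1).

Lemma qz0 : qz 0 = 0.
Proof. by rewrite /qz oppr0 subrr mul0r. Qed.

Lemma qint_qz k : qint q k = qz k%:Z.
Proof. by rewrite /qint /qz exprnN. Qed.

Lemma exprz_eq1 (z : int) : q ^ z = 1 -> z = 0.
Proof.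
case: z => [[|k]|k] //= h.
- by move: (hq k.+1 isT); rewrite -exprnP in h; rewrite h eqxx.
- move: (hq k.+1 isT); rewrite NegzE -exprnN in h.
  by rewrite -[q ^+ _]invrK h invr1 eqxx.
Qed.

Lemma exprz_inj (y z : int) : q ^ y = q ^ z -> y = z.
Proof.
move=> h; apply/eqP; rewrite -subr_eq0; apply/eqP/exprz_eq1.
by rewrite expfzDr // h -expfzDr // subrr.
Qed.

Lemma qzE (z : int) : qz z = (q ^ z - (q ^ z)^-1) / (q - q^-1).
Proof. by rewrite /qz invr_expz. Qed.

Lemma qq_neq0 : q - q^-1 != 0.
Proof.
rewrite subr_eq0; apply/eqP => h.
by move: (hq 2 isT); rewrite expr2 {2}h divff // eqxx.
Qed.

Lemma qz_neq0 z : z != 0 -> qz z != 0.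
Proof.
move=> z0; rewrite /qz mulf_neq0 ?invr_neq0 ?qq_neq0 // subr_eq0.
by apply: contra z0 => /eqP /exprz_inj h; apply/eqP; lia.
Qed.

(* The coordinate of [v] at [v_i (x) v_j], extended by 0 outside the index range. *)
Definition ev {m n} (v : Vec F m n) (i j : int) : F :=
  \sum_(k : Idx m n) (((k.1%:Z == i) && (k.2%:Z == j)) : nat)%:R * v k.

(** * The action of the generators on the coordinates of one module *)

Section OneModule.
Variables m n : nat.
Implicit Types (v w : Vec F m n) (k : Idx m n) (i j : int).

Lemma scaleoE (a : F) (x : F^o) : a *: x = a * x.
Proof. by []. Qed.

Lemma ev_idx v k : ev v k.1 k.2 = v k.
Proof.
rewrite /ev (bigD1 k) //= !eqxx mul1r big1 ?addr0 // => -[a b] /eqP h /=.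
case: eqP => [e1|]; last by rewrite mul0r.
case: eqP => [e2|]; last by rewrite mul0r.
by case: h; case: k e1 e2 => c e /= [e1] [e2]; congr pair; apply: val_inj.
Qed.

Lemma ev_out v i j :
  ~~ [&& 0 <= i, i <= m%:Z, 0 <= j & j <= n%:Z] -> ev v i j = 0.
Proof.
move=> h; rewrite /ev big1 // => -[a b] _ /=.
case: eqP => [e1|]; last by rewrite mul0r.
case: eqP => [e2|]; last by rewrite mul0r.
by have := ltn_ord a; have := ltn_ord b; lia.
Qed.

Lemma ev_in i j : [&& 0 <= i, i <= m%:Z, 0 <= j & j <= n%:Z] ->
  exists k : Idx m n, k.1%:Z = i /\ k.2%:Z = j.
Proof.
case: i => [i|i] h; last by lia.
case: j h => [j|j] h; last by lia.
have hi : (i < m.+1)%N by lia.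
have hj : (j < n.+1)%N by lia.
by exists (Ordinal hi, Ordinal hj).
Qed.

Lemma ev_add v w i j : ev (v + w) i j = ev v i j + ev w i j.
Proof.
by rewrite /ev -big_split; apply: eq_bigr => k _; rewrite ffunE mulrDr.
Qed.

Lemma linextE img v k' :
  @linext F m n img v k' = \sum_k v k * img k k'.
Proof. by rewrite /linext sum_ffunE; apply: eq_bigr => k _; rewrite ffunE. Qed.

Lemma linext_diag (e : Idx m n -> F) v k :
  linext (fun k => e k *: bv k) v k = e k * v k.
Proof.
rewrite linextE (bigD1 k) //= !ffunE eqxx big1 => [|k' h].
  by rewrite addr0 -[_ *: _]/(_ * _) mulr1 mulrC.
by rewrite !ffunE eq_sym (negPf h) scaler0 mulr0.
Qed.

Variables d l : F.

(** [E1] lowers the first index, so the coordinate at [k] is collected from the basis vector one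
    step higher: the coefficient of the definition appears with its index raised by one. *)
Lemma opE1E v k : opE1 q l v k =
  l * qz (k.1%:Z + 1) * qz (m%:Z - k.1%:Z) * ev v (k.1%:Z + 1) k.2.
Proof.
rewrite linextE /ev mulr_sumr; apply: eq_bigr => -[a b] _ /=.
case: eqP => ha; first by rewrite ffunE mulr0; case: eqP; [lia | rewrite mul0r mulr0].
rewrite !ffunE; case: k => c e /=.
(* Here [a] is nonzero, so [a.-1] is a genuine predecessor and [inord] does not fall back on its
   default value. *)
have hin : ((c, e) == (inord a.-1, b) :> Idx m n) = (a%:Z == c%:Z + 1) && (b%:Z == e%:Z).
  rewrite xpair_eqE -!val_eqE /= inordK; last by have := ltn_ord a; lia.
  by apply/andP/andP => -[/eqP h1 /eqP h2]; split; apply/eqP; lia.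
rewrite hin; case: andP => [[/eqP h1 /eqP h2]|_] /=; last first.
  by rewrite scaler0 !mulr0 mul0r mulr0.
rewrite -[_ *: _]/(_ * _) !qint_qz !mulr1 mul1r mulrC h1; congr (_ * qz _ * _).
by have := ltn_ord a; lia.
Qed.

Lemma opE2E v k : opE2 q d l v k =
  d * l * qz (k.2%:Z + 1) * qz (n%:Z - k.2%:Z) * ev v k.1 (k.2%:Z + 1).
Proof.
rewrite linextE /ev mulr_sumr; apply: eq_bigr => -[a b] _ /=.
case: eqP => hb.
  by rewrite ffunE mulr0 andbC; case: eqP; [lia | rewrite mul0r mulr0].
rewrite !ffunE; case: k => c e /=.
have hin : ((c, e) == (a, inord b.-1) :> Idx m n) = (a%:Z == c%:Z) && (b%:Z == e%:Z + 1).
  rewrite xpair_eqE -!val_eqE /= inordK; last by have := ltn_ord b; lia.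
  by apply/andP/andP => -[/eqP h1 /eqP h2]; split; apply/eqP; lia.
rewrite hin; case: andP => [[/eqP h1 /eqP h2]|_] /=; last first.
  by rewrite scaler0 !mulr0 mul0r mulr0.
rewrite -[_ *: _]/(_ * _) !qint_qz !mulr1 mul1r mulrC h2; congr (_ * qz _ * _).
by have := ltn_ord b; lia.
Qed.

Lemma opF1E v k : opF1 v k = ev v (k.1%:Z - 1) k.2.
Proof.
rewrite linextE /ev; apply: eq_bigr => -[a b] _ /=.
case: k => c e /=; case: eqP => ha.
  rewrite ffunE mulr0; case: eqP; last by rewrite mul0r.
  by have := ltn_ord c; lia.
rewrite ffunE mulrC.
have -> // : ((c, e) == (inord a.+1, b) :> Idx m n) = (a%:Z == c%:Z - 1) && (b%:Z == e%:Z).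
rewrite xpair_eqE -!val_eqE /= inordK; last by have := ltn_ord a; lia.
by apply/andP/andP => -[/eqP h1 /eqP h2]; split; apply/eqP; lia.
Qed.

Lemma opF2E v k : opF2 v k = ev v k.1 (k.2%:Z - 1).
Proof.
rewrite linextE /ev; apply: eq_bigr => -[a b] _ /=.
case: k => c e /=; case: eqP => hb.
  rewrite ffunE mulr0 andbC; case: eqP; last by rewrite mul0r.
  by have := ltn_ord e; lia.
rewrite ffunE mulrC.
have -> // : ((c, e) == (a, inord b.+1) :> Idx m n) = (a%:Z == c%:Z) && (b%:Z == e%:Z - 1).
rewrite xpair_eqE -!val_eqE /= inordK; last by have := ltn_ord b; lia.
by apply/andP/andP => -[/eqP h1 /eqP h2]; split; apply/eqP; lia.
Qed.

(** The upper bound matters: at [i = m + 1] the left side is zero by convention, whereas [ev v m j]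
    need not be. *)
Lemma ev_opF1 v i j : 0 <= i -> i <= m%:Z -> ev (opF1 v) i j = ev v (i - 1) j.
Proof.
move=> i0 im.
have [hj|hj] := boolP ((0 <= j) && (j <= n%:Z)); last by rewrite !ev_out //; lia.
have [k [<- <-]] : exists k : Idx m n, k.1%:Z = i /\ k.2%:Z = j.
  by apply: ev_in; lia.
by rewrite ev_idx opF1E.
Qed.

Lemma ev_opF2 v i j : 0 <= j -> j <= n%:Z -> ev (opF2 v) i j = ev v i (j - 1).
Proof.
move=> j0 jn.
have [hi|hi] := boolP ((0 <= i) && (i <= m%:Z)); last by rewrite !ev_out //; lia.
have [k [<- <-]] : exists k : Idx m n, k.1%:Z = i /\ k.2%:Z = j.
  by apply: ev_in; lia.
by rewrite ev_idx opF2E.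
Qed.

Definition k1 (i : int) : F := l * q ^ (m%:Z - 2 * i).
Definition k2 (j : int) : F := d * l^-1 * q ^ (n%:Z - 2 * j).

Lemma opK1E v k : opK1 q l v k = k1 k.1 * v k.
Proof. by rewrite /opK1 linext_diag /evK1 /k1 PoszM. Qed.

Lemma opK2E v k : opK2 q d l v k = k2 k.2 * v k.
Proof. by rewrite /opK2 linext_diag /evK2 /k2 PoszM. Qed.

Lemma opK1invE v k : opK1inv q l v k = (k1 k.1)^-1 * v k.
Proof. by rewrite /opK1inv linext_diag /evK1 /k1 PoszM. Qed.

Lemma opK2invE v k : opK2inv q d l v k = (k2 k.2)^-1 * v k.
Proof. by rewrite /opK2inv linext_diag /evK2 /k2 PoszM. Qed.

Lemma ev_opK2 v i j : ev (opK2 q d l v) i j = k2 j * ev v i j.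
Proof.
rewrite /ev mulr_sumr; apply: eq_bigr => k _; rewrite opK2E.
case: andP => [[_ /eqP ->]|_] /=; first by rewrite !mul1r.
by rewrite !mul0r mulr0.
Qed.

Lemma ev_opK2inv v i j : ev (opK2inv q d l v) i j = (k2 j)^-1 * ev v i j.
Proof.
rewrite /ev mulr_sumr; apply: eq_bigr => k _; rewrite opK2invE.
case: andP => [[_ /eqP ->]|_] /=; first by rewrite !mul1r.
by rewrite !mul0r mulr0.
Qed.

Definition kappa : F := (q - q^-1) ^+ 2.
(** Matrix entries of [B] on a weight space: [b_up] comes from [E1 F2], [b_down] from
    [K1^-1 E2 F1 K2], and [b_diag] from the four terms that preserve both indices. *)
Definition b_up (i : int) : F := kappa * l * qz (i + 1) * qz (m%:Z - i).
Definition b_down (i j : int) : F :=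
  kappa * (k1 i)^-1 * (d * l * qz (j + 1) * qz (n%:Z - j)) * k2 (j + 1).
Definition b_diag (i j : int) : F :=
  kappa * l * qz (i + 1) * qz (m%:Z - i) * k2 j
  + kappa * (k1 i)^-1 * (d * l * qz (j + 1) * qz (n%:Z - j))
  + q^-1 * (k1 i * k2 j) + q * ((k1 i)^-1 * (k2 j)^-1).

Lemma opBE v k : opB q d l v k = b_diag k.1 k.2 * v k
  + b_up k.1 * ev v (k.1%:Z + 1) (k.2%:Z - 1)
  + b_down k.1 k.2 * ev v (k.1%:Z - 1) (k.2%:Z + 1).
Proof.
rewrite /opB !ffunE !scaleoE opK1invE opE1E opE2E opK1E opK2E opK1invE opK2invE.
set i := k.1%:Z; set j := k.2%:Z.
have hi := ltn_ord k.1; have hj := ltn_ord k.2.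
have e1 : qz (m%:Z - i) * ev (opF1 (opK2 q d l v) + opF2 v) (i + 1) j
    = qz (m%:Z - i) * (k2 j * v k + ev v (i + 1) (j - 1)).
  have [->|him] := eqVneq (m%:Z - i) 0; first by rewrite qz0 !mul0r.
  rewrite ev_add ev_opF1 ?ev_opF2 ?ev_opK2; try by move: him; rewrite /i /j; lia.
  by rewrite addrK ev_idx.
have e2 : qz (n%:Z - j) * ev (opF1 (opK2 q d l v) + opF2 v) i (j + 1)
    = qz (n%:Z - j) * (k2 (j + 1) * ev v (i - 1) (j + 1) + v k).
  have [->|hjn] := eqVneq (n%:Z - j) 0; first by rewrite qz0 !mul0r.
  rewrite ev_add ev_opF1 ?ev_opF2 ?ev_opK2; try by move: hjn; rewrite /i /j; lia.
  by rewrite addrK ev_idx.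
rewrite -[l * _ * _ * _]mulrA e1 -[d * l * _ * _ * _]mulrA e2.
rewrite /b_diag /b_up /b_down /kappa; ring.
Qed.

(** The off-diagonal entry is expressed through [b_up] and an eigenvalue of [A], so that a matching
    established for [A] and [B] carries over to it. *)
Lemma opCE v k : opC q d l v k = l ^+ 2 * (k1 k.1)^-1 * v k
  - q * b_up k.1 * (k2 (k.2%:Z - 1))^-1 * ev v (k.1%:Z + 1) (k.2%:Z - 1).
Proof.
rewrite /opC !ffunE !scaleoE /opI linext_diag opK1invE opE1E.
set i := k.1%:Z; set j := k.2%:Z.
have hi := ltn_ord k.1; have hj := ltn_ord k.2.
have e1 : qz (m%:Z - i) * ev (opF2 (opK2inv q d l v)) (i + 1) j
    = qz (m%:Z - i) * ((k2 (j - 1))^-1 * ev v (i + 1) (j - 1)).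
  have [->|him] := eqVneq (m%:Z - i) 0; first by rewrite qz0 !mul0r.
  by rewrite ev_opF2 ?ev_opK2inv //; move: him; rewrite /i /j; lia.
rewrite -[l * _ * _ * _]mulrA e1 /b_up /kappa; ring.
Qed.

Definition eigK (ll : nat) : F := d * q ^ ((m + n)%N%:Z - (2 * ll)%N%:Z).

Hypothesis hd : d * d = 1.
Hypothesis hl : l != 0.

Lemma d_neq0 : d != 0.
Proof. by apply/eqP => d0; move: hd; rewrite d0 mul0r => /eqP; rewrite eq_sym oner_eq0. Qed.

Lemma k2_neq0 i : k2 i != 0.
Proof. by rewrite !mulf_neq0 ?expfz_neq0 ?invr_neq0 ?d_neq0. Qed.

(** In each of the four terms [l] meets its inverse, and [d] is its own inverse; hence [l] drops out
    and [d] is a global factor. *)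
Lemma b_diagE i j : b_diag i j = d * (
  kappa * qz (i + 1) * qz (m%:Z - i) * q ^ (n%:Z - 2 * j)
  + kappa * (q ^ (m%:Z - 2 * i))^-1 * qz (j + 1) * qz (n%:Z - j)
  + q^-1 * (q ^ (m%:Z - 2 * i) * q ^ (n%:Z - 2 * j))
  + q / (q ^ (m%:Z - 2 * i) * q ^ (n%:Z - 2 * j))).
Proof.
have dV : d^-1 = d by rewrite -[LHS]mulr1 -hd mulKf // d_neq0.
rewrite /b_diag /k1 /k2.
have := expfz_neq0 (m%:Z - 2 * i) hq0; have := expfz_neq0 (n%:Z - 2 * j) hq0.
set x := q ^ _; set y := q ^ _ => x0 y0.
have -> : q * ((l * y)^-1 * (d * l^-1 * x)^-1) = q * d^-1 / (y * x).
  by field; rewrite hl x0 y0 d_neq0.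
by rewrite dV; field; rewrite hq0 hl x0 y0.
Qed.

(** On [v_i (x) v_j] the operator [K1 K2] acts by [d * q ^ (m + n - 2 (i + j))]. As [q] is not a
    root of unity, distinct values of [i + j] give distinct eigenvalues. *)
Lemma inEigP ll v : reflect (forall k, (k.1 + k.2)%N != ll -> v k = 0)
  (inEig q d l (eigK ll) v).
Proof.
have e k : k1 k.1 * k2 k.2 = d * q ^ ((m + n)%N%:Z - (2 * (k.1 + k.2))%N%:Z).
  rewrite /k1 /k2; set x := q ^ _; set y := q ^ _.
  have -> : l * x * (d * l^-1 * y) = d * (x * y) by field.
  by rewrite -expfzDr //; congr (_ * q ^ _); lia.
apply: (iffP eqP) => [h k hk|h].
  move/ffunP/(_ k): h; rewrite opK1E opK2E ffunE scaleoE mulrA e.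
  move/eqP; rewrite -subr_eq0 -mulrBl mulf_eq0 => /orP [|/eqP //].
  rewrite /eigK -mulrBr mulf_eq0 (negPf d_neq0) subr_eq0 => /eqP /exprz_inj.
  by move: hk; lia.
apply/ffunP => k; rewrite opK1E opK2E ffunE scaleoE mulrA e.
by have [<- //|/h ->] := eqVneq (k.1 + k.2)%N ll; rewrite !mulr0.
Qed.

Lemma ev_eig ll v i j : inEig q d l (eigK ll) v -> i + j != ll%:Z -> ev v i j = 0.
Proof.
move/inEigP => hv hij.
have [h|/ev_out //] := boolP [&& 0 <= i, i <= m%:Z, 0 <= j & j <= n%:Z].
by have [k [h1 h2]] := ev_in _ _ h; rewrite -h1 -h2 ev_idx hv //; lia.
Qed.

End OneModule.

(** * Isomorphisms made of a shift of [j] by [s] and a diagonal rescaling by [c] *)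

Definition on_weight (m n ll : nat) (j : int) :=
  [&& 0 <= ll%:Z - j, ll%:Z - j <= m%:Z, 0 <= j & j <= n%:Z].

Section DiagonalIso.
Variables (m n ll m' n' ll' : nat) (d l l' : F) (s : int) (c : int -> F).
Hypothesis hd : d * d = 1.
Hypothesis hl : l != 0.
Hypothesis hl' : l' != 0.
Hypothesis hr : forall j, on_weight m' n' ll' j = on_weight m n ll (j + s).
Hypothesis hc : forall j, on_weight m' n' ll' j -> c j != 0.
Hypothesis hk2 : forall j, k2 n' d l' j = k2 n d l (j + s).
Hypothesis hk1 : forall j,
  l' ^+ 2 * (k1 m' l' (ll'%:Z - j))^-1 = l ^+ 2 * (k1 m l (ll%:Z - (j + s)))^-1.
Hypothesis hdiag : forall j,
  b_diag m' n' d l' (ll'%:Z - j) j = b_diag m n d l (ll%:Z - (j + s)) (j + s).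
Hypothesis hup : forall j, on_weight m' n' ll' j -> on_weight m' n' ll' (j - 1) ->
  c j * b_up m l (ll%:Z - (j + s)) = b_up m' l' (ll'%:Z - j) * c (j - 1).
Hypothesis hdown : forall j, on_weight m' n' ll' j -> on_weight m' n' ll' (j + 1) ->
  c j * b_down m n d l (ll%:Z - (j + s)) (j + s)
    = b_down m' n' d l' (ll'%:Z - j) j * c (j + 1).

(** Being zero off the target weight makes [f] a linear map on the whole module whose image always
    lies in the target weight space. The inverse [g] on weight spaces undoes shift and scaling. *)
Let f (v : Vec F m n) : Vec F m' n' :=
  [ffun k : Idx m' n' => if (k.1 + k.2)%N == ll' then
     c k.2 * ev v (ll%:Z - (k.2%:Z + s)) (k.2%:Z + s) else 0].

Let g (w : Vec F m' n') : Vec F m n :=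
  [ffun k : Idx m n => if (k.1 + k.2)%N == ll then
     (c (k.2%:Z - s))^-1 * ev w (ll'%:Z - (k.2%:Z - s)) (k.2%:Z - s) else 0].

(** Valid for every integer [j]: outside the range both sides vanish, since [hr] matches the two
    ranges. It may therefore be applied to neighbours of boundary indices. *)
Let ev_f v j : ev (f v) (ll'%:Z - j) j = c j * ev v (ll%:Z - (j + s)) (j + s).
Proof.
have [h|h] := boolP (on_weight m' n' ll' j); last first.
  by rewrite !ev_out ?mulr0 //; move: h; rewrite hr.
have [k [e1 e2]] := ev_in _ _ _ _ h.
have E : ev (f v) k.1 k.2 = c k.2 * ev v (ll%:Z - (k.2%:Z + s)) (k.2%:Z + s).
  by rewrite ev_idx ffunE; case: eqP => //; lia.
by rewrite e1 e2 in E.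
Qed.

Let f_lin a u v : f (a *: u + v) = a *: f u + f v.
Proof.
apply/ffunP => k; rewrite !ffunE; case: eqP => _; last by rewrite scaler0 addr0.
rewrite ev_add mulrDr scaleoE mulrCA; congr (_ * _ + _).
rewrite /ev mulr_sumr; apply: eq_bigr => k' _.
by rewrite ffunE scaleoE mulrCA.
Qed.

Let eigv (v : Vec F m n) := inEig q d l (eigK m n d ll) v.
Let eigw (w : Vec F m' n') := inEig q d l' (eigK m' n' d ll') w.

Let f_eig v : eigw (f v).
Proof. by apply/inEigP => // k hk; rewrite ffunE (negPf hk). Qed.

Let g_eig w : eigv (g w).
Proof. by apply/inEigP => // k hk; rewrite ffunE (negPf hk). Qed.

Let on_weight_idx (a b e : nat) (k : Idx a b) : (k.1 + k.2)%N = e -> on_weight a b e k.2.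
Proof. by rewrite /on_weight; have := ltn_ord k.1; have := ltn_ord k.2; lia. Qed.

Let ev_diag (a b e : nat) (v : Vec F a b) (k : Idx a b) :
  (k.1 + k.2)%N = e -> ev v (e%:Z - k.2%:Z) k.2 = v k.
Proof. by move=> <-; rewrite PoszD addrK ev_idx. Qed.

Let fg w : eigw w -> f (g w) = w.
Proof.
move=> hw; apply/ffunP => k; have [hk|hk] := eqVneq (k.1 + k.2)%N ll'; last first.
  by move/inEigP: (hw) => -> //; rewrite ffunE (negPf hk).
have hi := on_weight_idx _ _ _ _ hk.
rewrite ffunE hk eqxx; have := hi; rewrite hr => hi2.
have [k0 [e1 e2]] := ev_in _ _ _ _ hi2.
rewrite -e1 -e2 ev_idx ffunE e2 addrK ev_diag //.
case: eqP => [_|]; last by lia.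
by rewrite mulVKf // hc.
Qed.

Let f_inj u v : eigv u -> eigv v -> f u = f v -> u = v.
Proof.
move=> hu hv e; apply/ffunP => k.
have [hk|hk] := eqVneq (k.1 + k.2)%N ll; last first.
  by move/inEigP: hu => -> //; move/inEigP: hv => ->.
have hi := on_weight_idx _ _ _ _ hk.
have e' := congr1 (fun w => ev w (ll'%:Z - (k.2%:Z - s)) (k.2%:Z - s)) e.
move: e'; rewrite /= !ev_f subrK !ev_diag //; apply: mulfI.
by apply: hc; rewrite hr subrK.
Qed.

Let k_diag (a b e : nat) (k : Idx a b) : (k.1 + k.2)%N = e -> k.1%:Z = e%:Z - k.2%:Z.
Proof. by lia. Qed.

(* Both sides live on the same diagonal, so it suffices to compare coordinates there. *)
Let f_op (op : Vec F m n -> Vec F m n) (op' : Vec F m' n' -> Vec F m' n') v :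
  (forall k : Idx m' n', (k.1 + k.2)%N != ll' -> op' (f v) k = 0) ->
  (forall (k : Idx m' n') (k0 : Idx m n), (k.1 + k.2)%N = ll' ->
     k0.1%:Z = ll%:Z - (k.2%:Z + s) -> k0.2%:Z = k.2%:Z + s ->
     c k.2 * op v k0 = op' (f v) k) ->
  f (op v) = op' (f v).
Proof.
move=> h0 h1; apply/ffunP => k; have [hk|hk] := eqVneq (k.1 + k.2)%N ll'; last first.
  by rewrite h0 // ffunE (negPf hk).
have := on_weight_idx _ _ _ _ hk; rewrite hr => hi2.
have [k0 [e1 e2]] := ev_in _ _ _ _ hi2.
by rewrite -(h1 _ k0 hk e1 e2) ffunE hk eqxx -e1 -e2 ev_idx.
Qed.

(** If [j - 1] stays in the range, this is [hup]; otherwise the coordinate of [v] common to both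
    sides is zero. *)
Let up_term v j : on_weight m' n' ll' j ->
  c j * (b_up m l (ll%:Z - (j + s))
         * ev v (ll%:Z - (j + s) + 1) (j + s - 1))
  = b_up m' l' (ll'%:Z - j) * ev (f v) (ll'%:Z - j + 1) (j - 1).
Proof.
move=> hj.
have -> : ll'%:Z - j + 1 = ll'%:Z - (j - 1) by lia.
have -> : ll%:Z - (j + s) + 1 = ll%:Z - (j - 1 + s) by lia.
have -> : j + s - 1 = j - 1 + s by lia.
rewrite ev_f mulrA.
have [h|h] := boolP (on_weight m' n' ll' (j - 1)); first by rewrite hup // mulrA.
by rewrite (ev_out _ _ v) ?mulr0 //; move: h; rewrite hr.
Qed.

Let down_term v j : on_weight m' n' ll' j ->
  c j * (b_down m n d l (ll%:Z - (j + s)) (j + s)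
         * ev v (ll%:Z - (j + s) - 1) (j + s + 1))
  = b_down m' n' d l' (ll'%:Z - j) j * ev (f v) (ll'%:Z - j - 1) (j + 1).
Proof.
move=> hj.
have -> : ll'%:Z - j - 1 = ll'%:Z - (j + 1) by lia.
have -> : ll%:Z - (j + s) - 1 = ll%:Z - (j + 1 + s) by lia.
have -> : j + s + 1 = j + 1 + s by lia.
rewrite ev_f mulrA.
have [h|h] := boolP (on_weight m' n' ll' (j + 1)); first by rewrite hdown // mulrA.
by rewrite (ev_out _ _ v) ?mulr0 //; move: h; rewrite hr.
Qed.

Lemma diagonal_iso :
  Hq_iso q d l m n (eigK m n d ll) d l' m' n' (eigK m' n' d ll').
Proof.
exists f; split => //; first by move=> w hw; exists (g w); rewrite ?fg.
move=> v hv.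
have off (k : Idx m' n') (i j : int) : (k.1 + k.2)%N != ll' ->
    i + j = k.1%:Z + k.2%:Z -> ev (f v) i j = 0.
  by move=> hk hij; apply: (ev_eig _ _ _ _ hd hl' ll') => //; lia.
have off0 (k : Idx m' n') : (k.1 + k.2)%N != ll' -> f v k = 0.
  by move=> hk; rewrite ffunE (negPf hk).
split; apply: f_op => [k hk|k k0 hk e1 e2].
- by rewrite /opA opK2invE off0 ?mulr0.
- rewrite /opA !opK2invE e2 hk2 -(ev_diag _ _ _ (f v) _ hk) ev_f -e1 -e2 ev_idx.
  by rewrite mulrCA.
- rewrite opBE off0 // !(off k) //; try lia.
  by rewrite !mulr0 !addr0.
- have hi := on_weight_idx _ _ _ _ hk.
  rewrite !opBE e1 e2 (k_diag _ _ _ _ hk) !mulrDr up_term // down_term //.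
  rewrite -(ev_diag _ _ _ (f v) _ hk) ev_f hdiag -[v k0]ev_idx e1 e2.
  by congr (_ + _ + _); rewrite mulrCA.
- rewrite opCE off0 // !(off k) //; try lia.
  by rewrite !mulr0 subr0.
have hi := on_weight_idx _ _ _ _ hk.
rewrite !opCE e1 e2 (k_diag _ _ _ _ hk) hk1 hk2 mulrBr; congr (_ - _).
  by rewrite -(ev_diag _ _ _ (f v) _ hk) ev_f -[v k0]ev_idx e1 e2 mulrCA.
have -> : k.2%:Z - 1 + s = k.2%:Z + s - 1 by lia.
(* By [hk2] both sides carry the same factor [u], and what remains is the off-diagonal part of [B]
   already settled by [up_term]. *)
set u := (k2 _ _ _ _)^-1; have := up_term v _ hi.
set x := b_up _ _ _; set y := b_up _ _ _; set z := ev _ _ _; set t := ev _ _ _ => h.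
have -> : c k.2 * (q * x * u * z) = q * u * (c k.2 * (x * z)) by ring.
by rewrite h; ring.
Qed.

End DiagonalIso.

(** * q-factorials and the two involutions *)

Definition qfact (z : int) : F := \prod_(t < `|z|%N) qz t.+1%:Z.

(** At negative arguments [qfact] takes the absolute value: it never vanishes, but the recurrence is
    stated from [z = 0] on. *)
Lemma qfactS z : 0 <= z -> qfact (z + 1) = qfact z * qz (z + 1).
Proof.
case: z => // k _; rewrite /qfact -[1]/(1%N%:Z) -PoszD addn1 !absz_nat.
by rewrite big_ord_recr.
Qed.

Lemma qfact_neq0 z : qfact z != 0.
Proof. by apply/prodf_neq0 => t _; apply: qz_neq0. Qed.

Lemma exprzD a b : q ^ (a + b) = q ^ a * q ^ b.
Proof. exact: expfzDr. Qed.

Lemma exprz_opp a : q ^ (- a) = (q ^ a)^-1.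
Proof. by rewrite invr_expz. Qed.

Lemma exprz_double a : q ^ (2 * a) = q ^ a * q ^ a.
Proof. by rewrite mulrC -exprz_exp. Qed.

(** Expands linear exponents into monomials in [q] and its powers at atomic exponents, a form in
    which [field] can verify the identities below. *)
Definition exprzE := (exprz_double, exprzD, exprz_opp, expr1z).

Lemma exprq_neq0 z : q ^ z != 0.
Proof. exact: expfz_neq0. Qed.

Lemma sqr_sub1_neq0 : q * q - 1 != 0.
Proof. by rewrite subr_eq0; apply: hq 2 isT. Qed.

Lemma iso_swap_n_ll (m n ll : nat) (d l : F) : d * d = 1 -> l != 0 -> (ll <= m + n)%N ->
  Hq_iso q d l m n (eigK m n d ll)
    d (l * q ^ (ll%:Z - n%:Z)) (m + n - ll) ll (eigK (m + n - ll) ll d n).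
Proof.
move=> hd hl hll.
have eN : (m + n - ll)%N%:Z = m%:Z + n%:Z - ll%:Z by lia.
have d0 := d_neq0 d hd.
have [x0 y0 z0] : [/\ q ^ m%:Z != 0, q ^ n%:Z != 0 & q ^ ll%:Z != 0].
  by split; apply: exprq_neq0.
have hl' : l * q ^ (ll%:Z - n%:Z) != 0 by rewrite mulf_neq0 // exprq_neq0.
(* Both index ranges are the same, whence the shift 0. The scaling solves the recursion imposed by
   [hup], namely [c j / c (j - 1) = q^(ll - n) [n - j + 1] / [ll - j + 1]]. *)
apply: (@diagonal_iso _ _ _ _ _ _ _ _ _ 0
  (fun j => q ^ ((ll%:Z - n%:Z) * j) * qfact (ll%:Z - j) / qfact (n%:Z - j))) => //.
- by move=> j; rewrite /on_weight addr0; lia.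
- by move=> j _; rewrite !mulf_neq0 ?invr_neq0 ?qfact_neq0 ?exprq_neq0.
- move=> j; have t0 := exprq_neq0 j; rewrite addr0 /k2 !exprzE.
  by field; rewrite ?hl ?t0 ?x0 ?y0 ?z0 ?hq0.
- move=> j; have t0 := exprq_neq0 j; rewrite addr0 /k1 eN !exprzE.
  by field; rewrite ?hl ?t0 ?x0 ?y0 ?z0 ?hq0.
- move=> j; have t0 := exprq_neq0 j.
  rewrite addr0 !b_diagE // /kappa !qzE eN !exprzE.
  by field; rewrite ?hl ?t0 ?x0 ?y0 ?z0 ?hq0 ?d0 ?sqr_sub1_neq0.
- move=> j; rewrite /on_weight => h h'; rewrite addr0 /b_up eN.
  have -> : ll%:Z - (j - 1) = ll%:Z - j + 1 by lia.
  have -> : n%:Z - (j - 1) = n%:Z - j + 1 by lia.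
  rewrite !qfactS; try lia.
  have -> : m%:Z + n%:Z - ll%:Z - (n%:Z - j) = m%:Z - (ll%:Z - j) by lia.
  (* The exponent is quadratic in the variables; splitting off one step leaves the same power of [q]
     on both sides, to be treated as an atom. *)
  have -> : (ll%:Z - n%:Z) * j = (ll%:Z - n%:Z) * (j - 1) + (ll%:Z - n%:Z) by ring.
  rewrite !exprzD; have Hq : qz (n%:Z - j + 1) != 0 by apply: qz_neq0; lia.
  by field; rewrite ?Hq ?qfact_neq0.
move=> j; rewrite /on_weight => h h'; rewrite addr0 /b_down.
have -> : ll%:Z - j = ll%:Z - (j + 1) + 1 by lia.
have -> : n%:Z - j = n%:Z - (j + 1) + 1 by lia.
rewrite !qfactS; try lia.
rewrite /k1 /k2 eN.
have -> : (ll%:Z - n%:Z) * (j + 1) = (ll%:Z - n%:Z) * j + (ll%:Z - n%:Z) by ring.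
have t0 := exprq_neq0 j; have w0 := exprq_neq0 ((ll%:Z - n%:Z) * j).
have [H1 H2] : qz (n%:Z - (j + 1) + 1) != 0 /\ qz (ll%:Z - (j + 1) + 1) != 0.
  by split; apply: qz_neq0; lia.
rewrite !exprzE.
by field; rewrite ?H1 ?H2 ?qfact_neq0 ?hl ?t0 ?x0 ?y0 ?z0 ?hq0 ?d0 ?sqr_sub1_neq0.
Qed.

Lemma iso_swap_m_ll (m n ll : nat) (d l : F) : d * d = 1 -> l != 0 -> (ll <= m + n)%N ->
  Hq_iso q d l m n (eigK m n d ll)
    d (l * q ^ (ll%:Z - m%:Z)) ll (m + n - ll) (eigK ll (m + n - ll) d m).
Proof.
move=> hd hl hll.
have eN : (m + n - ll)%N%:Z = m%:Z + n%:Z - ll%:Z by lia.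
have d0 := d_neq0 d hd.
have [x0 y0 z0] : [/\ q ^ m%:Z != 0, q ^ n%:Z != 0 & q ^ ll%:Z != 0].
  by split; apply: exprq_neq0.
have hl' : l * q ^ (ll%:Z - m%:Z) != 0 by rewrite mulf_neq0 // exprq_neq0.
(* This shift preserves the first index, as [ll - (j + s) = m - j]. The recursion from [hup] is now
   [c j / c (j - 1) = q^s [j + s] / [j]] with [s = ll - m]. *)
apply: (@diagonal_iso _ _ _ _ _ _ _ _ _ (ll%:Z - m%:Z)
  (fun j => q ^ ((ll%:Z - m%:Z) * j) * qfact (j + (ll%:Z - m%:Z)) / qfact j)) => //.
- by move=> j; rewrite /on_weight; lia.
- by move=> j _; rewrite !mulf_neq0 ?invr_neq0 ?qfact_neq0 ?exprq_neq0.
- move=> j; have t0 := exprq_neq0 j; rewrite /k2 eN !exprzE.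
  by field; rewrite ?hl ?t0 ?x0 ?y0 ?z0 ?hq0.
- move=> j; have t0 := exprq_neq0 j; rewrite /k1 !exprzE.
  by field; rewrite ?hl ?t0 ?x0 ?y0 ?z0 ?hq0.
- move=> j; have t0 := exprq_neq0 j.
  rewrite !b_diagE // /kappa !qzE eN !exprzE.
  by field; rewrite ?hl ?t0 ?x0 ?y0 ?z0 ?hq0 ?d0 ?sqr_sub1_neq0.
- move=> j; rewrite /on_weight => h h'; rewrite /b_up.
  have := qfactS (j - 1) ltac:(lia); have := qfactS (j - 1 + (ll%:Z - m%:Z)) ltac:(lia).
  have -> : j - 1 + (ll%:Z - m%:Z) + 1 = j + (ll%:Z - m%:Z) by lia.
  have -> : m%:Z - (ll%:Z - (j + (ll%:Z - m%:Z))) = j by lia.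
  rewrite subrK => -> ->.
  have -> : ll%:Z - (j + (ll%:Z - m%:Z)) = m%:Z - j by lia.
  have -> : ll%:Z - (m%:Z - j) = j + (ll%:Z - m%:Z) by lia.
  have -> : (ll%:Z - m%:Z) * j = (ll%:Z - m%:Z) * (j - 1) + (ll%:Z - m%:Z) by ring.
  rewrite !exprzD; have Hq : qz j != 0 by apply: qz_neq0; lia.
  by field; rewrite ?Hq ?qfact_neq0.
move=> j; rewrite /on_weight => h h'; rewrite /b_down.
have -> : j + 1 + (ll%:Z - m%:Z) = j + (ll%:Z - m%:Z) + 1 by lia.
rewrite !qfactS; try lia.
rewrite /k1 /k2 eN.
have -> : m%:Z + n%:Z - ll%:Z - j = n%:Z - (j + (ll%:Z - m%:Z)) by lia.
have -> : (ll%:Z - m%:Z) * (j + 1) = (ll%:Z - m%:Z) * j + (ll%:Z - m%:Z) by ring.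
have t0 := exprq_neq0 j; have w0 := exprq_neq0 ((ll%:Z - m%:Z) * j).
have [H1 H2] : qz (j + 1) != 0 /\ qz (j + (ll%:Z - m%:Z) + 1) != 0.
  by split; apply: qz_neq0; lia.
rewrite !exprzE.
by field; rewrite ?H1 ?H2 ?qfact_neq0 ?hl ?t0 ?x0 ?y0 ?z0 ?hq0 ?d0 ?sqr_sub1_neq0.
Qed.

(** * Composition of isomorphisms, and two formulas for the converse *)

Lemma Hq_iso_trans (d l : F) (m n : nat) (t d' l' : F) (m' n' : nat) (t' : F)
    (d'' l'' : F) (m'' n'' : nat) (t'' : F) :
  Hq_iso q d l m n t d' l' m' n' t' -> Hq_iso q d' l' m' n' t' d'' l'' m'' n'' t'' ->
  Hq_iso q d l m n t d'' l'' m'' n'' t''.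
Proof.
move=> [f [fL fE fI fS fO]] [g [gL gE gI gS gO]]; exists (g \o f); split => /=.
- by move=> a u v; rewrite fL gL.
- by move=> v /fE /gE.
- by move=> u v hu hv /gI h; apply: fI => //; apply: h; apply: fE.
- by move=> w /gS [v /fS [u hu <-] <-]; exists u.
by move=> v hv; have [-> -> ->] := fO _ hv; apply: gO; apply: fE.
Qed.

Lemma Hq_iso_refl (d l : F) (m n : nat) (t : F) : Hq_iso q d l m n t d l m n t.
Proof. by exists id; split => // w hw; exists w. Qed.

(** Once [d], [n] and [2 ll - m] are known, the only unknown left in this coefficient is
    [q^(m+1) + q^-(m+1)]. *)
Lemma b_diag_top (m n ll : nat) (d l : F) : d * d = 1 -> l != 0 ->
  b_diag m n d l ll 0 = d * (q ^ n%:Z * (q ^ (m%:Z + 1) + (q ^ (m%:Z + 1))^-1)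
    - q ^ (2 * ll%:Z - m%:Z) * (q ^ (n%:Z - 1) - q ^ (- n%:Z - 1))).
Proof.
move=> hd hl; rewrite b_diagE // /kappa !qzE mulr0 !subr0 add0r !exprzE.
have [x0 y0 z0] : [/\ q ^ m%:Z != 0, q ^ n%:Z != 0 & q ^ ll%:Z != 0].
  by split; apply: exprq_neq0.
by field; rewrite ?x0 ?y0 ?z0 ?hq0 ?sqr_sub1_neq0.
Qed.

Lemma addV_inj (x y : F) : x != 0 -> y != 0 ->
  x + x^-1 = y + y^-1 -> x = y \/ x * y = 1.
Proof.
move=> x0 y0 h; have : (x - y) * (x * y - 1) = 0.
  have -> : (x - y) * (x * y - 1) = x * y * (x + x^-1 - (y + y^-1)).
    by field; rewrite x0 y0.
  by rewrite h subrr mulr0.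
move/eqP; rewrite mulf_eq0 !subr_eq0 => /orP [] /eqP; by [left | right].
Qed.

(** * Invariants of an isomorphism: the spectrum of [A] and the coefficients at [j = 0] *)

Section Invariants.
Variables (m n ll m' n' ll' : nat) (d l d' l' : F).
Hypothesis hd : d * d = 1.
Hypothesis hd' : d' * d' = 1.
Hypothesis hl : l != 0.
Hypothesis hl' : l' != 0.

Let eigv (v : Vec F m n) := inEig q d l (eigK m n d ll) v.
Let eigw (w : Vec F m' n') := inEig q d' l' (eigK m' n' d' ll') w.

Variable f : Vec F m n -> Vec F m' n'.
Hypothesis f_lin : forall a u v, f (a *: u + v) = a *: f u + f v.
Hypothesis f_eig : forall v, eigv v -> eigw (f v).
Hypothesis f_inj : forall u v, eigv u -> eigv v -> f u = f v -> u = v.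
Hypothesis f_surj : forall w, eigw w -> exists2 v, eigv v & f v = w.
Hypothesis fA : forall v, eigv v -> f (opA q d l v) = opA q d' l' (f v).

Let f0 : f 0 = 0.
Proof.
by have := f_lin 1 0 0; rewrite !scale1r addr0 => /eqP; rewrite -subr_eq0 opprD addNKr oppr_eq0 => /eqP.
Qed.

Let fZ a v : f (a *: v) = a *: f v.
Proof. by rewrite -[a *: v]addr0 f_lin f0 addr0. Qed.

Let eig_bv (k : Idx m n) : (k.1 + k.2)%N = ll -> eigv (bv k).
Proof.
move=> hk; apply/inEigP => // k' hk'; rewrite ffunE.
by case: eqP => // e; move: hk'; rewrite e hk eqxx.
Qed.

Let eig_bv' (k : Idx m' n') : (k.1 + k.2)%N = ll' -> eigw (bv k).
Proof.
move=> hk; apply/inEigP => // k' hk'; rewrite ffunE.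
by case: eqP => // e; move: hk'; rewrite e hk eqxx.
Qed.

Let bv_neq0 (a b : nat) (k : Idx a b) : bv k != 0 :> Vec F a b.
Proof.
apply/eqP => /ffunP /(_ k); rewrite !ffunE eqxx => /eqP.
by rewrite oner_eq0.
Qed.

Let eigZ a v : eigv v -> eigv (a *: v).
Proof.
by move=> /inEigP h; apply/inEigP => // k hk; rewrite ffunE h // scaler0.
Qed.

Let opA_eig v : eigv v -> eigv (opA q d l v).
Proof.
by move=> /inEigP h; apply/inEigP => // k hk; rewrite /opA opK2invE h // mulr0.
Qed.

Let opA_f v a (k : Idx m' n') : eigv v -> opA q d l v = a *: v -> f v k != 0 ->
  a = (k2 n' d' l' k.2)^-1.
Proof.
move=> hv hA hk; have := fA _ hv; rewrite hA fZ => /ffunP /(_ k).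
by rewrite ffunE scaleoE /opA opK2invE; apply: mulIf.
Qed.

Let opA_bv (k : Idx m n) : opA q d l (bv k) = (k2 n d l k.2)^-1 *: bv k.
Proof.
apply/ffunP => k'; rewrite /opA opK2invE !ffunE scaleoE.
by case: eqP => [->|] //; rewrite !mulr0.
Qed.

Let nz_coord (a b : nat) (v : Vec F a b) : v != 0 -> exists k, v k != 0.
Proof.
move=> hv; have [/existsP //|] := boolP [exists k, v k != 0].
rewrite negb_exists => /forallP h; case/eqP: hv; apply/ffunP => k.
by rewrite ffunE; apply/eqP; have := h k; rewrite negbK.
Qed.

Let f_neq0 v : eigv v -> v != 0 -> f v != 0.
Proof.
move=> hv; apply: contra => /eqP h; apply/eqP; apply: f_inj => //; last by rewrite f0.
by apply/inEigP => // k _; rewrite ffunE.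
Qed.

(** The image of [bv k] is a nonzero eigenvector of [A], and [A] is diagonal on the target; any
    nonzero coordinate of the image gives [k']. *)
Lemma spec_image (k : Idx m n) : (k.1 + k.2)%N = ll -> exists2 k' : Idx m' n',
  (k'.1 + k'.2)%N = ll' & k2 n d l k.2 = k2 n' d' l' k'.2.
Proof.
move=> hk; have hv := eig_bv _ hk.
have [k' hk'] := nz_coord _ _ _ (f_neq0 _ hv (bv_neq0 _ _ k)).
exists k'; last by apply: invr_inj; apply: opA_f hk' => //; apply: opA_bv.
apply/eqP; apply: contraNT hk' => h; apply/eqP.
by move/inEigP: (f_eig _ hv) => ->.
Qed.

(** A preimage of [bv k'] is itself an eigenvector of [A] by injectivity of [f], and any of its
    nonzero coordinates gives [k]. *)
Lemma spec_preimage (k' : Idx m' n') : (k'.1 + k'.2)%N = ll' -> exists2 k : Idx m n,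
  (k.1 + k.2)%N = ll & k2 n d l k.2 = k2 n' d' l' k'.2.
Proof.
move=> hk'; have [v hv fv] := f_surj _ (eig_bv' _ hk').
have v0 : v != 0.
  by apply: contra_neq (bv_neq0 _ _ k'); rewrite -fv => ->.
have [k hk] := nz_coord _ _ _ v0; exists k.
  apply/eqP; apply: contraNT hk => h; apply/eqP.
  by move/inEigP: hv => ->.
have hA : opA q d l v = (k2 n' d' l' k'.2)^-1 *: v.
  apply: f_inj; [exact: opA_eig | exact: eigZ | rewrite fA // fZ fv].
  apply/ffunP => j; rewrite /opA opK2invE !ffunE scaleoE.
  by case: eqP => [->|] //; rewrite !mulr0.
apply: invr_inj; move/ffunP/(_ k): hA; rewrite /opA opK2invE ffunE scaleoE.
exact: mulIf.
Qed.

Hypothesis hn : (n <= ll <= m)%N.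
Hypothesis hn' : (n' <= ll' <= m')%N.

(** In the normalized region no value of [j] between 0 and [b] is cut off, because [e - j] stays
    between 0 and [a]. *)
Let idx (a b e : nat) : (b <= e <= a)%N -> forall j : nat, (j <= b)%N ->
  exists2 k : Idx a b, (k.1 + k.2)%N = e & k.2 = j :> nat.
Proof.
move=> h j hj; have [|k [e1 e2]] := ev_in a b (e%:Z - j%:Z) j%:Z; first by lia.
by exists k; lia.
Qed.

(** The eigenvalues of [K2] form a progression of ratio [q^-2], one for each [j]. Two such
    progressions with the same values have the same start and the same length. *)
Lemma top_eigenvalue : n = n' /\ k2 n d l 0 = k2 n' d' l' 0.
Proof.
have k2E a b c (j : int) : k2 a b c j = k2 a b c 0 * q ^ (- 2 * j).
  by rewrite /k2 -[RHS]mulrA -expfzDr //; congr (_ * q ^ _); lia.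
have K0 := k2_neq0 n d l hd hl 0; have K0' := k2_neq0 n' d' l' hd' hl' 0.
have [p0 P0 p00] := idx m n ll hn 0%N (leq0n n).
have [p0' P0' p00'] := idx m' n' ll' hn' 0%N (leq0n n').
have [s _ es] := spec_image _ P0; have [s' _ es'] := spec_preimage _ P0'.
have E : k2 n d l 0 = k2 n' d' l' 0.
  rewrite p00 [RHS]k2E in es; rewrite p00' [LHS]k2E in es'.
  (* Each start lies [s], respectively [s'], steps after the other; the two nonnegative numbers sum
     to zero. *)
  have : q ^ (- 2 * s.2%:Z + - 2 * s'.2%:Z) = 1.
    apply: (mulfI K0'); rewrite mulr1 exprzD mulrA -es.
    by rewrite es'.
  move/exprz_eq1 => h; have s0 : s.2%:Z = 0 by lia.
  by rewrite es s0 mulr0 mulr1.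
split => //.
have [pn Pn pnn] := idx m n ll hn n (leqnn n).
have [pn' Pn' pnn'] := idx m' n' ll' hn' n' (leqnn n').
have [t _ et] := spec_image _ Pn; have [t' _ et'] := spec_preimage _ Pn'.
(* With equal starts, the last index [n] occurs among [0..n'] and [n'] among [0..n]. *)
rewrite k2E [RHS]k2E -E pnn in et; rewrite k2E [RHS]k2E -E pnn' in et'.
move/(mulfI K0)/exprz_inj: et; move/(mulfI K0)/exprz_inj: et'.
by have := ltn_ord t.2; have := ltn_ord t'.2; lia.
Qed.

(* An operator that maps the top vector into e times itself plus a multiple of
   its neighbour is seen through f at the top coordinate as multiplication by e. *)
Lemma top_coefficient (op : Vec F m n -> Vec F m n) (op' : Vec F m' n' -> Vec F m' n')
    (e e' : F) :
  (forall v, eigv v -> eigv (op v)) ->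
  (forall v, eigv v -> f (op v) = op' (f v)) ->
  (forall (u : Vec F m n) (k : Idx m n), (forall k : Idx m n, (0 < k.2)%N -> u k = 0) -> eigv u ->
    k.2 <> 1%N :> nat -> op u k = e * u k) ->
  (forall (u : Vec F m' n') (k : Idx m' n'), (forall k : Idx m' n', (0 < k.2)%N -> u k = 0) -> eigw u ->
    (k.1 + k.2)%N = ll' -> k.2 = 0%N :> nat -> op' u k = e' * u k) ->
  e = e'.
Proof.
move=> hop hf h1 h2; have [nn' k2E] := top_eigenvalue.
have [k0 hk0 k00] := idx m n ll hn 0%N (leq0n n).
have [k0' hk0' k00'] := idx m' n' ll' hn' 0%N (leq0n n').
have hu := eig_bv _ hk0; set u := bv k0 in hu.
have k2_inj (i j : int) : k2 n' d' l' i = k2 n' d' l' j -> i = j.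
  move/mulfI; rewrite mulf_neq0 ?invr_neq0 ?(d_neq0 d' hd') // => /(_ isT).
  by move/exprz_inj; lia.
have supp (v : Vec F m n) (j : int) (k : Idx m' n') : eigv v -> opA q d l v = (k2 n d l j)^-1 *: v ->
    f v k != 0 -> k.2%:Z = j.
  move=> hv hA hk; have := opA_f _ _ _ hv hA hk => /invr_inj.
  have -> : k2 n d l j = k2 n' d' l' j.
    move: k2E; rewrite /k2 -nn' => /mulIf; rewrite expfz_neq0 // => /(_ isT) ->.
    by [].
  by move/k2_inj.
have u0 (k : Idx m n) : (0 < k.2)%N -> u k = 0.
  by rewrite ffunE; case: eqP => // ->; rewrite k00.
have g0 (k : Idx m' n') : (0 < k.2)%N -> f u k = 0.
  move=> hk; apply/eqP; apply: contraTT hk => hk.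
  have := supp u 0 k hu _ hk; rewrite opA_bv k00 => /(_ erefl); lia.
(* [f u] is nonzero and supported at [j = 0], where the target weight space has the single index
   [k0']. *)
have g1 : f u k0' != 0.
  have [k hk] := nz_coord _ _ _ (f_neq0 _ hu (bv_neq0 _ _ k0)).
  have kk : k.2 = 0%N :> nat.
    by apply/eqP; apply: contraNT hk => h; rewrite g0 ?eqxx ?lt0n.
  have kd : (k.1 + k.2)%N = ll'.
    by apply/eqP; apply: contraNT hk => h; move/inEigP: (f_eig _ hu) => ->.
  have -> // : k0' = k.
  case: k k0' hk0' k00' kk kd {hk} => [a b] [a' b'] /= h3 h4 h5 h6.
  by congr pair; apply: val_inj => /=; lia.
(* The remainder [op u - e u] is supported at [j = 1], so it satisfies the eigenvector equation of
   [A] there; a nonzero coordinate of its image at [j = 0] would give [0 = 1]. *)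
have fr : f ((- e) *: u + op u) k0' = 0.
  apply/eqP; apply/contraT => h; have := supp _ 1 k0' _ _ h; rewrite k00'.
  have hr : eigv (- e *: u + op u).
    have /(inEigP _ _ _ _ hd hl) Hop := hop _ hu; have /(inEigP _ _ _ _ hd hl) Hu := hu.
    by apply/inEigP => // k hk; rewrite ffunE Hop // addr0 ffunE Hu // scaler0.
  move=> /(_ hr) H; suff // : 0%N%:Z = 1 by [].
  apply: H; apply/ffunP => k; rewrite /opA opK2invE [RHS]ffunE scaleoE.
  have [->//|/eqP k1n] := eqVneq (k.2 : nat) 1%N.
  by rewrite ffunE h1 // ffunE scaleoE mulNr addNr !mulr0.
move: fr; rewrite f_lin ffunE hf // h2 //; last exact: f_eig.
rewrite ffunE scaleoE -mulrDl => /eqP; rewrite mulf_eq0 (negPf g1) orbF addrC.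
by rewrite subr_eq0 => /eqP.
Qed.

End Invariants.

(** * Recovering the parameters in the region [n <= ll <= m] *)

Lemma ev_top (a b : nat) (u : Vec F a b) i j :
  (forall k : Idx a b, (0 < k.2)%N -> u k = 0) -> j != 0 -> ev u i j = 0.
Proof.
move=> hu j0.
have [h|/ev_out //] := boolP [&& 0 <= i, i <= a%:Z, 0 <= j & j <= b%:Z].
by have [k [h1 h2]] := ev_in _ _ _ _ h; rewrite -h1 -h2 ev_idx hu //; lia.
Qed.

Lemma opB_eig (m n ll : nat) (d l : F) (v : Vec F m n) : d * d = 1 -> l != 0 ->
  inEig q d l (eigK m n d ll) v -> inEig q d l (eigK m n d ll) (opB q d l v).
Proof.
move=> hd hl hv; apply/inEigP => // k hk; rewrite opBE -ev_idx.
by rewrite !(ev_eig _ _ _ _ hd hl _ _ _ _ hv) ?mulr0 ?addr0 //; lia.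
Qed.

Lemma opC_eig (m n ll : nat) (d l : F) (v : Vec F m n) : d * d = 1 -> l != 0 ->
  inEig q d l (eigK m n d ll) v -> inEig q d l (eigK m n d ll) (opC q d l v).
Proof.
move=> hd hl hv; apply/inEigP => // k hk; rewrite opCE -[v k]ev_idx.
by rewrite !(ev_eig _ _ _ _ hd hl _ _ _ _ hv) ?mulr0 ?subr0 //; lia.
Qed.

Lemma normalized_iso_eq (m n ll m' n' ll' : nat) (d l d' l' : F) :
  d * d = 1 -> d' * d' = 1 -> l != 0 -> l' != 0 ->
  (n <= ll <= m)%N -> (n' <= ll' <= m')%N ->
  Hq_iso q d l m n (eigK m n d ll) d' l' m' n' (eigK m' n' d' ll') ->
  d = d' /\ (m', n', ll', l') = (m, n, ll, l).
Proof.
move=> hd hd' hl hl' hn hn' [f [fL fE fI fS fO]].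
have fA v hv := let: And3 h _ _ := fO v hv in h.
have fB v hv := let: And3 _ h _ := fO v hv in h.
have fC v hv := let: And3 _ _ h := fO v hv in h.
have [nn' k2E] := top_eigenvalue _ _ _ _ _ _ _ _ _ _ hd hd' hl hl' f fL fE fI fS fA hn hn'.
have top := top_coefficient _ _ _ _ _ _ _ _ _ _ hd hd' hl hl' f fL fE fI fS fA hn hn'.
have cE : l ^+ 2 * (k1 m l ll)^-1 = l' ^+ 2 * (k1 m' l' ll')^-1.
  apply: (top _ _ _ _ (fun v => opC_eig _ _ _ _ _ v hd hl) fC)
      => [u k hu /(inEigP _ _ _ _ hd hl) he hk|u k hu _ hk hk0].
    rewrite opCE ev_top //; last by lia.
    rewrite mulr0 subr0; have [kl|/he ->] := eqVneq (k.1 + k.2)%N ll; last by rewrite !mulr0.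
    have [k20|/hu ->] := posnP k.2; last by rewrite !mulr0.
    by rewrite -kl k20 addn0.
  by rewrite opCE ev_top ?mulr0 ?subr0 ?hk0 // -hk hk0 addn0.
have bE : b_diag m n d l ll 0 = b_diag m' n' d' l' ll' 0.
  apply: (top _ _ _ _ (fun v => opB_eig _ _ _ _ _ v hd hl) fB)
      => [u k hu /(inEigP _ _ _ _ hd hl) he hk|u k hu _ hk hk0].
    rewrite opBE !ev_top //; try by lia.
    rewrite !mulr0 !addr0; have [kl|/he ->] := eqVneq (k.1 + k.2)%N ll; last by rewrite !mulr0.
    have [k20|/hu ->] := posnP k.2; last by rewrite !mulr0.
    by rewrite -kl k20 addn0.
  by rewrite opBE !ev_top ?mulr0 ?addr0 ?hk0 // -hk hk0 addn0.
subst n'; have d0 := d_neq0 d hd; have d0' := d_neq0 d' hd'.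
(* The top eigenvalues of [K2] give [d / l = d' / l'], which fixes [l'] up to the sign [d * d']. *)
have el : l' = d * d' * l.
  move: k2E; rewrite /k2 => /mulIf; rewrite exprq_neq0 => /(_ isT) h.
  have -> : l = d * (d * l^-1)^-1 by field; rewrite hl d0.
  have -> : d * d' * (d * (d * l^-1)^-1) = (d * d) * d' * (d * l^-1)^-1 by ring.
  by rewrite h hd; field; rewrite hl' d0'.
(* Squaring removes the sign [x], which is [d * d'] below. The exponents then agree, and this in
   turn forces the sign to be 1. *)
have sq x : x ^+ 2 = 1 -> q ^ (2 * ll%:Z - m%:Z) = x * q ^ (2 * ll'%:Z - m'%:Z) ->
    2 * ll%:Z - m%:Z = 2 * ll'%:Z - m'%:Z /\ x = 1.
  move=> x1 hx; have e : 2 * ll%:Z - m%:Z = 2 * ll'%:Z - m'%:Z.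
    have : q ^ (2 * (2 * ll%:Z - m%:Z)) = q ^ (2 * (2 * ll'%:Z - m'%:Z)).
      by rewrite !exprz_double hx mulrACA -[x * x]expr2 x1 mul1r.
    by move/exprz_inj; lia.
  split=> //; apply: (mulIf (exprq_neq0 (2 * ll'%:Z - m'%:Z))).
  by rewrite -hx e mul1r.
have kE a e b : b != 0 -> b ^+ 2 * (k1 a b e)^-1 = b * q ^ (2 * e - a%:Z).
  move=> b0; rewrite /k1 -[2 * e - _]opprB exprz_opp.
  by have := exprq_neq0 (a%:Z - 2 * e); set y := q ^ _ => y0; field; rewrite b0 y0.
have [e1 dd] : 2 * ll%:Z - m%:Z = 2 * ll'%:Z - m'%:Z /\ d * d' = 1.
  apply: sq; first by rewrite expr2 mulrACA hd hd' mulr1.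
  by apply: (mulfI hl); move: cE; rewrite !kE // el => ->; ring.
have ed : d = d' by rewrite -[d]mulr1 -hd' mulrA dd mul1r.
have ll_eq : l' = l by rewrite el dd mul1r.
split=> //; move: bE; rewrite -ed ll_eq !b_diag_top // e1 => /(mulfI d0) /addIr /(mulfI (exprq_neq0 _)).
move/(addV_inj _ _ (exprq_neq0 _) (exprq_neq0 _)) => [/exprz_inj h|].
  by have [-> ->] : m' = m /\ ll' = ll by lia.
(* The other root would make [q ^ (m + m' + 2)] equal to 1. *)
by rewrite -exprzD => /exprz_eq1; lia.
Qed.

(** * The four parameters as an orbit of a Klein four-group *)

Definition orbit4 (m n ll : nat) (l : F) (m' n' ll' : nat) (l' : F) :=
  [\/ (m', n', ll', l') = (m, n, ll, l),
      (m', n', ll', l') = ((m + n - ll)%N, ll, n, l * q ^ (ll%:Z - n%:Z)),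
      (m', n', ll', l') = (ll, (m + n - ll)%N, m, l * q ^ (ll%:Z - m%:Z))
    | (m', n', ll', l') = (n, m, (m + n - ll)%N,
                            l * q ^ ((2 * ll)%N%:Z - (m + n)%N%:Z))].

Lemma tuple4_eq (m n ll m' n' ll' : nat) (l l' : F) :
  m' = m -> n' = n -> ll' = ll -> l' = l -> (m', n', ll', l') = (m, n, ll, l).
Proof. by move=> -> -> -> ->. Qed.

Lemma mul_exprz_exprz (l : F) (a b c : int) : a + b = c -> l * q ^ a * q ^ b = l * q ^ c.
Proof. by move=> <-; rewrite exprzD mulrA. Qed.

Lemma mul_exprz_exprz0 (l : F) (a b : int) : a + b = 0 -> l * q ^ a * q ^ b = l.
Proof. by move/mul_exprz_exprz => ->; rewrite expr0z mulr1. Qed.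

(** A check of the sixteen composites; [ll <= m + n] makes the natural number subtractions exact. *)
Lemma orbit4_trans (m n ll m' n' ll' m'' n'' ll'' : nat) (l l' l'' : F) :
  (ll <= m + n)%N -> orbit4 m n ll l m' n' ll' l' ->
  orbit4 m' n' ll' l' m'' n'' ll'' l'' -> orbit4 m n ll l m'' n'' ll'' l''.
Proof.
move=> hll [] [-> -> -> ->] [] [-> -> -> ->];
  first [ apply: Or41; apply: tuple4_eq => //; (lia || (apply: mul_exprz_exprz0; lia))
        | apply: Or42; apply: tuple4_eq => //; (lia || (apply: mul_exprz_exprz; lia))
        | apply: Or43; apply: tuple4_eq => //; (lia || (apply: mul_exprz_exprz; lia))
        | apply: Or44; apply: tuple4_eq => //; (lia || (apply: mul_exprz_exprz; lia))].
Qed.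

(** Each of the four transformations is its own inverse. *)
Lemma orbit4_sym (m n ll m' n' ll' : nat) (l l' : F) :
  (ll <= m + n)%N -> orbit4 m n ll l m' n' ll' l' -> orbit4 m' n' ll' l' m n ll l.
Proof.
move=> hll [] [-> -> -> ->]; [apply: Or41 | apply: Or42 | apply: Or43 | apply: Or44];
  apply: tuple4_eq => //; (lia || (rewrite mul_exprz_exprz0 //; lia)).
Qed.

Lemma orbit4_iso (m n ll m' n' ll' : nat) (d l l' : F) :
  d * d = 1 -> l != 0 -> (ll <= m + n)%N -> orbit4 m n ll l m' n' ll' l' ->
  Hq_iso q d l m n (eigK m n d ll) d l' m' n' (eigK m' n' d ll').
Proof.
move=> hd hl hll [] [-> -> -> ->]; [exact: Hq_iso_refl | exact: iso_swap_n_ll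
  | exact: iso_swap_m_ll |].
(* The fourth member is reached by exchanging [n] with [ll] and then the new [m] with the new
   [ll]. *)
have hl2 : l * q ^ (ll%:Z - n%:Z) != 0 by rewrite mulf_neq0 // exprq_neq0.
have := Hq_iso_trans _ _ _ _ _ _ _ _ _ _ _ _ _ _ _
  (iso_swap_n_ll m n ll d l hd hl hll)
  (iso_swap_m_ll (m + n - ll) ll n d _ hd hl2 ltac:(lia)).
have -> : (m + n - ll + ll - n = m)%N by lia.
by rewrite (@mul_exprz_exprz _ _ _ ((2 * ll)%N%:Z - (m + n)%N%:Z)) //; lia.
Qed.

(** The comparisons of [ll] with [n] and with [m] leave four cases, each normalized by a different
    member of the orbit. *)
Lemma orbit4_normal (m n ll : nat) (l : F) : (ll <= m + n)%N ->
  exists m' n' ll' l', (n' <= ll' <= m')%N /\ orbit4 m n ll l m' n' ll' l'.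
Proof.
move=> hll; have [h1|h1] := leqP n ll; have [h2|h2] := leqP ll m.
- by exists m, n, ll, l; split; [lia | apply: Or41].
- by do 4!eexists; split; last (apply: Or43; reflexivity); lia.
- by do 4!eexists; split; last (apply: Or42; reflexivity); lia.
by do 4!eexists; split; last (apply: Or44; reflexivity); lia.
Qed.

Lemma orbit4_neq0 (m n ll m' n' ll' : nat) (l l' : F) :
  l != 0 -> orbit4 m n ll l m' n' ll' l' -> l' != 0.
Proof.
by move=> hl [] [_ _ _ ->] //; rewrite mulf_neq0 // exprq_neq0.
Qed.

(** For the forward direction both sides are moved to normal forms, which must coincide by
    [normalized_iso_eq]; the two orbits then share a member. *)
Lemma Hq_iso_orbit4 (m n m' n' : nat) (d d' l l' : F) (ll ll' : nat) :
  d * d = 1 -> d' * d' = 1 -> l != 0 -> l' != 0 ->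
  (ll <= m + n)%N -> (ll' <= m' + n')%N ->
  Hq_iso q d l m n (eigK m n d ll) d' l' m' n' (eigK m' n' d' ll')
  <-> d = d' /\ orbit4 m n ll l m' n' ll' l'.
Proof.
move=> hd hd' hl hl' hll hll'; split=> [iso|[<-]]; last exact: orbit4_iso.
have [m0 [n0 [ll0 [l0 [h0 o0]]]]] := orbit4_normal m n ll l hll.
have [m1 [n1 [ll1 [l1 [h1 o1]]]]] := orbit4_normal m' n' ll' l' hll'.
have hl0 := orbit4_neq0 _ _ _ _ _ _ _ _ hl o0.
have hl1 := orbit4_neq0 _ _ _ _ _ _ _ _ hl' o1.
have o0' := orbit4_sym _ _ _ _ _ _ _ _ hll o0.
have o1' := orbit4_sym _ _ _ _ _ _ _ _ hll' o1.
(* Symmetry of the orbit relation supplies the isomorphism out of the normal form, in place of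
   inverting one. *)
have i0 : Hq_iso q d l0 m0 n0 (eigK m0 n0 d ll0) d l m n (eigK m n d ll).
  by apply: orbit4_iso => //; lia.
have i1 := orbit4_iso _ _ _ _ _ _ _ _ _ hd' hl' hll' o1.
have i01 := Hq_iso_trans _ _ _ _ _ _ _ _ _ _ _ _ _ _ _ i0
  (Hq_iso_trans _ _ _ _ _ _ _ _ _ _ _ _ _ _ _ iso i1).
have [-> [em en ell el]] := normalized_iso_eq _ _ _ _ _ _ _ _ _ _ hd hd' hl0 hl1 h0 h1 i01.
split=> //; apply: (orbit4_trans _ _ _ _ _ _ _ _ _ _ _ _ hll o0).
by rewrite -em -en -ell -el.
Qed.

End Coordinates.

Theorem mainTheorem13 (R : realType) (q : R[i])
  (hq0 : q != 0) (hq : forall k : nat, (0 < k)%N -> q ^+ k != 1)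
  (m n m' n' : nat) (d d' l l' : R[i])
  (hd : d = 1 \/ d = -1) (hd' : d' = 1 \/ d' = -1)
  (hl : l != 0) (hl' : l' != 0)
  (ll ll' : nat) (hll : (ll <= m + n)%N) (hll' : (ll' <= m' + n')%N) :
  Hq_iso q d l m n (d * q ^ ((m + n)%N%:Z - (2 * ll)%N%:Z))
           d' l' m' n' (d' * q ^ ((m' + n')%N%:Z - (2 * ll')%N%:Z))
  <->
  d = d' /\
  [\/ (m', n', ll', l') = (m, n, ll, l),
      (m', n', ll', l') = ((m + n - ll)%N, ll, n, l * q ^ (ll%:Z - n%:Z)),
      (m', n', ll', l') = (ll, (m + n - ll)%N, m, l * q ^ (ll%:Z - m%:Z))
    | (m', n', ll', l') = (n, m, (m + n - ll)%N,
                            l * q ^ ((2 * ll)%N%:Z - (m + n)%N%:Z))].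
Proof.
by apply: (Hq_iso_orbit4 _ _ hq0 hq) => //;
  [case: hd => -> | case: hd' => ->]; rewrite ?mulrNN mulr1.
Qed.
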